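(* Let $k$ be a field (of arbitrary characteristic), let $M\cong\mathbb{Z}^d$ be a free abelian group of rank $d$, let $S\subset M$ be a finitely generated submonoid that generates $M$ as a group, and let $R=k[S]$. Let $I$ and $\mathfrak{a}=(x^{\mathbf a}\mid\mathbf a\in\mathcal{A})$ be monomial ideals of $R$, with $\mathcal{A}\subset S$ finite, let $H$ be the convex hull of $\mathcal{A}$ in $M\otimes_{\mathbb{Z}}\mathbb{R}$, let $t\in\mathbb{R}_{>0}$, and let $x^{\mathbf v}\in R$ be a monomial. If $x^{\mathbf v}\in\overline{I}^{\mathfrak{a}^t}$, then $\mathbf v+tH\subset\operatorname{Hull}(\operatorname{Exp}I)$; and if $k[S]$ is normal, then the converse holds.
   Context: $x^{\mathbf v}$ ($\mathbf v\in S$) denotes the monomial of $k[S]$ with exponent $\mathbf v$. $\operatorname{Exp}I=\{\mathbf v\in S\mid x^{\mathbf v}\in I\}$ and $\operatorname{Hull}$ denotes convex hull in $M\otimes_{\mathbb{Z}}\mathbb{R}\cong\mathbb{R}^d$. $R^\circ$ is the set of elements of $R$ not in any minimal prime, i.e. the nonzero elements here. The $\mathfrak{a}^t$-integral closure is $$\overline{I}^{\mathfrak{a}^t}=\{x\in R\mid\text{for some }c\in R^\circ\text{ and all }n\gg0,\ cx^n\mathfrak{a}^{\lceil tn\rceil}\subset I^n\}.$$ *)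

(* Defs.v *)
From HB Require Import structures.
From mathcomp Require Import all_boot all_order all_algebra finmap.
From mathcomp Require Import boolp classical_sets reals interval_inference.
From mathcomp Require Import topology convex.
From mathcomp.multinomials Require Import monalg.

Set Implicit Arguments.
Unset Strict Implicit.
Unset Printing Implicit Defensive.

Import Order.TTheory GRing.Theory Num.Theory.

Local Open Scope classical_set_scope.
Local Open Scope ring_scope.

Section SubmonoidType.
Context {M : zmodType} (S : addrClosed M).

Record submonoid := Submonoid { smval : M; _ : smval \in S }.

HB.instance Definition _ := [isSub for smval].
HB.instance Definition _ := [Choice of submonoid by <:].

Fact submonoid_closed : addr_closed [pred v | v \in S].
Proof. by split=> [|u v]; rewrite !inE; [exact: rpred0 | exact: rpredD]. Qed.

HB.instance Definition _ :=
  GRing.SubChoice_isSubNmodule.Build M _ submonoid submonoid_closed.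

Definition fg_submonoid := exists gs : seq M,
  {subset gs <= S} /\
  forall T : addrClosed M, {subset gs <= T} -> {subset S <= T}.

Definition generates_group :=
  forall G : zmodClosed M, {subset S <= G} -> forall v, v \in G.

End SubmonoidType.

(* The library puts a ring structure on malg k N only when 0 is the only
   invertible element of N (monomType), which excludes, e.g., N = Z; hence the
   alias and the convolution product below. *)
Definition monoid_algebra (k : nzRingType) (N : nmodType) := malg N k.

Section MonoidAlgebra.
Context (k : comNzRingType) (N : nmodType).
Local Notation A := (monoid_algebra k N).
Implicit Types (f g : A) (v w : N).

HB.instance Definition _ := GRing.Zmodule.on A.

Definition cmonom (c : k) v : A := mkmalgU v c.

Definition convol f g : A :=
  \sum_(v <- msupp f) \sum_(w <- msupp g)
    cmonom (mcoeff v f * mcoeff w g) (v + w).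

Fact cmonom0 v : cmonom 0 v = 0.
Proof. exact: monalgU0. Qed.

Fact cmonomD v : {morph cmonom^~ v : c d / c + d}.
Proof. by move=> c d; exact: monalgUD. Qed.

Fact supp_cmonom c v : (msupp (cmonom c v) `<=` [fset v])%fset.
Proof. exact: msuppU_le. Qed.

Fact cmonomK c v : mcoeff v (cmonom c v) = c.
Proof. by rewrite /cmonom mcoeffUU. Qed.

Fact cmonom_sum f : f = \sum_(v <- msupp f) cmonom (mcoeff v f) v.
Proof. exact: monalgE. Qed.

Fact convol_sup (d e : {fset N}) f g :
    (msupp f `<=` d)%fset -> (msupp g `<=` e)%fset ->
  convol f g = \sum_(v <- d) \sum_(w <- e)
    cmonom (mcoeff v f * mcoeff w g) (v + w).
Proof.
move=> fd ge; rewrite /convol (big_fset_incl _ fd) => [|v _ vf] /=.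
  apply: eq_bigr => v _; rewrite (big_fset_incl _ ge) // => w _ wg.
  by rewrite (mcoeff_outdom wg) mulr0 cmonom0.
by apply: big1 => w _; rewrite (mcoeff_outdom vf) mul0r cmonom0.
Qed.

Fact convolC : commutative convol.
Proof.
move=> f g; rewrite /convol exchange_big /=; apply: eq_bigr => v _.
by apply: eq_bigr => w _; rewrite mulrC addrC.
Qed.

Fact convolDl : left_distributive convol +%R.
Proof.
move=> f g h; set d := (msupp f `|` msupp g)%fset.
rewrite (@convol_sup d (msupp h) (f + g) h) ?msuppD_le //.
rewrite (@convol_sup d (msupp h) f h) ?fsubsetUl //.
rewrite (@convol_sup d (msupp h) g h) ?fsubsetUr //.
rewrite -big_split; apply: eq_bigr => v _.
rewrite -big_split; apply: eq_bigr => w _.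
by rewrite [mcoeff v _]mcoeffD mulrDl cmonomD.
Qed.

Fact convolDr : right_distributive convol +%R.
Proof. by move=> f g h; rewrite ![convol f _]convolC convolDl. Qed.

Fact convol0l : left_zero 0 convol.
Proof. by move=> f; apply: (addrI (convol 0 f)); rewrite -convolDl !addr0. Qed.

Fact convol0r : right_zero 0 convol.
Proof. by move=> f; rewrite convolC convol0l. Qed.

Fact convolUU c d v w :
  convol (cmonom c v) (cmonom d w) = cmonom (c * d) (v + w).
Proof.
by rewrite (convol_sup (supp_cmonom c v) (supp_cmonom d w)) !big_seq_fset1
   !cmonomK.
Qed.

Fact convol_suml I (r : seq I) (F : I -> A) g :
  convol (\sum_(i <- r) F i) g = \sum_(i <- r) convol (F i) g.
Proof.
exact: (big_morph (convol^~ g) (fun _ _ => convolDl _ _ _) (convol0l _)).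
Qed.

Fact convol_sumr I (r : seq I) (F : I -> A) g :
  convol g (\sum_(i <- r) F i) = \sum_(i <- r) convol g (F i).
Proof.
exact: (big_morph (convol g) (fun _ _ => convolDr _ _ _) (convol0r _)).
Qed.

Fact convolA : associative convol.
Proof.
move=> f g h; rewrite (cmonom_sum f) !convol_suml; apply: eq_bigr => u _.
rewrite (cmonom_sum g) !(convol_suml, convol_sumr); apply: eq_bigr => v _.
rewrite (cmonom_sum h) !convol_sumr; apply: eq_bigr => w _.
by rewrite !convolUU mulrA addrA.
Qed.

Fact convol1l : left_id (cmonom 1 0) convol.
Proof.
move=> f; rewrite {1}(cmonom_sum f) convol_sumr [RHS]cmonom_sum.
by apply: eq_bigr => v _; rewrite convolUU mul1r add0r.
Qed.

Fact cmonom1_neq0 : cmonom 1 0 != 0 :> A.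
Proof. by rewrite [_ == _]monalgU_eq0 oner_neq0. Qed.

HB.instance Definition _ := GRing.Zmodule_isComNzRing.Build A
  convolA convolC convol1l convolDl cmonom1_neq0.

Definition monom v : A := cmonom 1 v.

End MonoidAlgebra.

Arguments monom k {N} v.

Section CommutativeAlgebra.
Context {A : comNzRingType}.
Implicit Types (I J P X a : set A).

(* Unlike ring_quotient's idealr, ideals may be improper. *)
Definition is_ideal I := [/\ I 0,
  forall x y, I x -> I y -> I (x + y) &
  forall x y, I y -> I (x * y)].

Definition ideal_gen X : set A := smallest is_ideal X.

Definition ideal_mul I J := ideal_gen [set x * y | x in I & y in J].

Definition ideal_pow I (n : nat) := iter n (ideal_mul I) setT.

Definition prime_ideal P := [/\ is_ideal P, ~ P 1 &
  forall x y, P (x * y) -> P x \/ P y].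

Definition minimal_prime P :=
  prime_ideal P /\ forall Q, prime_ideal Q -> Q `<=` P -> Q = P.

Definition Rcirc : set A := [set c | forall P, minimal_prime P -> ~ P c].

(* The absolute value only converts the integer ceiling, which is nonnegative
   for t > 0, to a natural number. *)
Definition a_t_closure {R : realType} I a (t : R) : set A :=
  [set x | exists2 c, Rcirc c & \forall n \near \oo, forall y,
     ideal_pow a `|Num.ceil (t * n%:R)|%N y ->
     ideal_pow I n (c * x ^+ n * y)].

End CommutativeAlgebra.

Definition is_fraction_field (A : comNzRingType) (K : fieldType)
    (f : {rmorphism A -> K}) :=
  injective f /\ forall z, exists x y, y <> 0 /\ z = f x / f y.

(* Integrally closed in its fraction field; the injectivity of f forces A to
   be a domain. *)
Definition normal_domain (A : comNzRingType) :=
  exists (K : fieldType) (f : {rmorphism A -> K}),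
    is_fraction_field f /\
    forall z, integralOver f z -> exists x, z = f x.

Definition is_monomial_ideal (k : comNzRingType) (N : nmodType)
    (I : set (monoid_algebra k N)) :=
  exists E : set N, I = ideal_gen (monom k @` E).

Definition Exp (k : comNzRingType) (N : nmodType)
  (I : set (monoid_algebra k N)) : set N := [set v | I (monom k v)].

Definition Hull {R : realType} {E : lmodType R} (X : set E) : set E :=
  smallest (@convex_set R E) X.

(* The map M -> M (x) R = R^d induced by coordinates e : M -> Z^d. *)
Definition real_coords (R : realType) {M : zmodType} {d : nat}
  (e : M -> 'rV[int]_d) (v : M) : 'rV[R]_d := map_mx intr (e v).

(* Main.v *)
From HB Require Import structures.
Require Import Defs.
From mathcomp Require Import all_boot all_order all_algebra finmap.
From mathcomp Require Import boolp classical_sets reals.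
From mathcomp Require Import interval_inference topology convex.
From mathcomp.multinomials Require Import monalg.
From mathcomp Require Import ring lra.

Set Implicit Arguments.
Unset Strict Implicit.
Unset Printing Implicit Defensive.

Import Order.TTheory GRing.Theory Num.Theory.
Local Open Scope classical_set_scope.
Local Open Scope ring_scope.

(** The monomials of k[S] are the points of S, a finitely generated submonoid
    of the lattice Z^d, and by Dickson's lemma Exp I = E0 + S for a finite set
    E0 of generators.  Hence Hull (Exp I) is a polyhedron: a point p lies in it
    iff (1, p) lies in the cone C spanned by the (1, e), e in E0, and the
    (0, g), g a generator of S ([Hull_Exp_cone]), and C is cut out by finitely
    many linear inequalities with integer coefficients ([cone_polyhedral], by
    Fourier-Motzkin elimination).  Everything happens in C; note that
    (n, u) lies in C as soon as x^u is in I^n.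

    If x^v is in the closure, witnessed by c, choose w in the support of c
    (which is nonzero since k[S] is a domain).  For a in A and m = ceil(tn) the
    monomial x^(ma) is in a^m, so c x^(nv + ma) is in I^n and, I^n being a
    monomial ideal, so is x^(w + nv + ma).  Each inequality l >= 0 defining C
    therefore holds at (n, w + nv + ma), which is n (1, v + ta) up to a bounded
    vector; dividing by n and letting n grow gives l (1, v + ta) >= 0.  So
    v + ta is in the hull for all a in A, and v + tH follows by convexity
    ([closure_sub_Hull]).

    Conversely assume v + tH is in the hull.  If u is a sum of m = ceil(tn)
    elements of A, adding up the m points (1, v + ta) and rescaling shows that
    (n, nv + u) is in C.  Rounding up the coefficients at the (1, e) costs at
    most sum E0 ([cone_round_up]): nv + u + sum E0 = z + q with x^z in I^N,
    N >= n, and q in the real cone of S.  Now q is a lattice point, so it is in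
    the rational cone of S, because the same integer inequalities define both;
    hence a multiple of q is in S ([lattice_cone_nspan]).  Normality of k[S]
    puts q itself in S ([normal_saturated]), and c = x^(sum E0) witnesses that
    x^v is in the closure ([Hull_sub_closure]). *)

(** * Finitely generated cones are polyhedral *)

Fixpoint cone (F : numDomainType) (V : lmodType F) (gs : seq V) (p : V) : Prop :=
  if gs is g :: gs' then exists c q, [/\ 0 <= c, cone gs' q & p = c *: g + q]
  else p = 0.

Section Cone.
Context {F : numDomainType}.
Implicit Types V W : lmodType F.

Lemma cone0 V (gs : seq V) : cone gs 0.
Proof. by elim: gs => //= g gs IH; exists 0, 0; rewrite scale0r addr0. Qed.

Lemma coneD V (gs : seq V) p q : cone gs p -> cone gs q -> cone gs (p + q).
Proof.
elim: gs p q => /= [|g gs IH] p q; first by move=> -> ->; rewrite addr0.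
move=> [b] [p'] [b0 Hp ->] [c] [q'] [c0 Hq ->]; exists (b + c), (p' + q').
by split; [exact: addr_ge0 | exact: IH | rewrite scalerDl addrACA].
Qed.

Lemma coneZ V (gs : seq V) c p : 0 <= c -> cone gs p -> cone gs (c *: p).
Proof.
move=> c0; elim: gs p => /= [|g gs IH] p; first by move=> ->; rewrite scaler0.
move=> [b] [p'] [b0 Hp ->]; exists (c * b), (c *: p').
by split; [exact: mulr_ge0 | exact: IH | rewrite scalerDr scalerA].
Qed.

Lemma cone_mem V (gs : seq V) g : g \in gs -> cone gs g.
Proof.
elim: gs => //= h gs IH; rewrite inE => /predU1P[->|/IH Hg].
  by exists 1, 0; rewrite scale1r addr0; split=> //; exact: cone0.
by exists 0, g; rewrite scale0r add0r.
Qed.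

Lemma cone_min V (gs : seq V) (P : V -> Prop) : P 0 ->
  (forall c g q, 0 <= c -> g \in gs -> P q -> P (c *: g + q)) ->
  forall p, cone gs p -> P p.
Proof.
move=> P0; elim: gs => [|g gs IH] PD p /=; first by move->.
move=> [c] [q] [c0 Hq ->]; apply: (PD); rewrite ?mem_head //.
by apply: IH Hq => b h r b0 hgs; apply: PD; rewrite // inE hgs orbT.
Qed.

End Cone.

Definition dot (F : pzRingType) n (l p : 'rV[F]_n) : F := \sum_i l 0 i * p 0 i.

Section Dot.
Context {F : comNzRingType} {n : nat}.
Implicit Types l p q : 'rV[F]_n.

Lemma dotDr l p q : dot l (p + q) = dot l p + dot l q.
Proof.
by rewrite /dot -big_split /=; apply: eq_bigr => i _; rewrite mxE mulrDr.
Qed.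

Lemma dotZr l c p : dot l (c *: p) = c * dot l p.
Proof.
by rewrite /dot mulr_sumr; apply: eq_bigr => i _; rewrite mxE mulrCA.
Qed.

Lemma dotC l p : dot l p = dot p l.
Proof. by apply: eq_bigr => i _; rewrite mulrC. Qed.

Lemma dot0r l : dot l 0 = 0.
Proof. by apply: big1 => i _; rewrite mxE mulr0. Qed.

Lemma dotNr l p : dot l (- p) = - dot l p.
Proof. by rewrite -scaleN1r dotZr mulN1r. Qed.

Lemma dot_delta p i : dot (delta_mx 0 i) p = p 0 i.
Proof.
rewrite /dot (bigD1 i) //= mxE !eqxx mul1r big1 ?addr0 // => j ji.
by rewrite mxE eqxx (negPf ji) mul0r.
Qed.

End Dot.

Notation int_mx F := (@map_mx int F intr _ _).

Lemma dot_intr (F : comNzRingType) n (l p : 'rV[int]_n) :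
  dot (int_mx F l) (int_mx F p) = (dot l p)%:~R.
Proof.
by rewrite /dot rmorph_sum; apply: eq_bigr => i _; rewrite !mxE rmorphM.
Qed.

(** Fourier-Motzkin elimination of c from the inequalities
    l (p - c g) >= 0, c >= 0.  Those with l g = 0 do not mention c, those with
    l g > 0 bound c above (and are compared with the bound 0), those with
    l g < 0 bound it below, and each upper bound is compared with each lower
    one.  Cross-multiplying instead of dividing keeps the coefficients
    integral. *)
Definition eliminate n (g : 'rV[int]_n) (ls : seq 'rV[int]_n) :=
  [seq l <- ls | 0 <= dot l g] ++
  [seq dot l g *: l' - dot l' g *: l
     | l <- [seq l <- ls | 0 < dot l g], l' <- [seq l <- ls | dot l g < 0]].

Lemma exists_between (F : realFieldType) (lo up : seq F) :
  (forall x y, x \in lo -> y \in up -> x <= y) ->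
  exists c, (forall x, x \in lo -> x <= c) /\ (forall y, y \in up -> c <= y).
Proof.
elim: lo => [|x lo IH] Hlu.
  elim: up {Hlu} => [|y up [c [_ Hc]]]; first by exists 0.
  exists (Num.min y c); split=> // z; rewrite inE => /predU1P[->|/Hc Hz].
    by rewrite ge_min lexx.
  by rewrite ge_min Hz orbT.
have [|c [Hlo Hup]] := IH.
  by move=> z y zl yu; apply: Hlu; rewrite // inE zl orbT.
exists (Num.max x c); split=> z.
  rewrite inE => /predU1P[->|/Hlo Hz]; rewrite le_max ?lexx //.
  by rewrite Hz orbT.
by move=> zu; rewrite ge_max Hup // Hlu ?mem_head.
Qed.

Lemma eliminateP n (g : 'rV[int]_n) ls (F : realFieldType) (p : 'rV[F]_n) :
  (exists2 c, 0 <= c &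
     forall l, l \in ls -> 0 <= dot (int_mx F l) (p - c *: int_mx F g)) <->
  (forall l, l \in eliminate g ls -> 0 <= dot (int_mx F l) p).
Proof.
have dotE l c : dot (int_mx F l) (p - c *: int_mx F g)
    = dot (int_mx F l) p - c * (dot l g)%:~R.
  by rewrite dotDr dotNr dotZr dot_intr.
have combE l l' : dot (int_mx F (dot l g *: l' - dot l' g *: l)) p
    = (dot l g)%:~R * dot (int_mx F l') p - (dot l' g)%:~R * dot (int_mx F l) p.
  by rewrite map_mxB !map_mxZ dotC dotDr dotNr !dotZr ![dot p _]dotC.
split=> [[c c0 Hc] l|Hl].
  rewrite mem_cat => /orP[|/allpairsPdep [l1 [l2]]].
    rewrite mem_filter => /andP[lg /Hc]; rewrite dotE subr_ge0.
    by apply: le_trans; rewrite mulr_ge0 // ler0z.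
  rewrite !mem_filter => -[/andP[l1g /Hc H1] /andP[l2g /Hc H2] ->].
  move: H1 H2; rewrite combE !dotE.
  move: (dot (int_mx F l1) p) (dot (int_mx F l2) p) => x1 x2.
  have: (0 : F) < (dot l1 g)%:~R by rewrite ltr0z.
  have: (dot l2 g)%:~R < 0 :> F by rewrite ltrz0.
  move: ((dot l1 g)%:~R : F) ((dot l2 g)%:~R : F) => y1 y2 *; nra.
pose B l := dot (int_mx F l) p / (dot l g)%:~R.
have [x y|c [Hlo Hup]] := @exists_between F
    (0 :: [seq B l | l <- ls & dot l g < 0]) [seq B l | l <- ls & 0 < dot l g].
  move=> xlo /mapP[l1]; rewrite mem_filter => /andP[g1 h1] ->.
  move: xlo; rewrite inE => /predU1P[->|/mapP[l2]].
    rewrite divr_ge0 ?ler0z ?(ltW g1) //; apply: Hl.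
    by rewrite mem_cat mem_filter (ltW g1) h1.
  rewrite mem_filter => /andP[g2 h2] ->.
  have /Hl : dot l1 g *: l2 - dot l2 g *: l1 \in eliminate g ls.
    rewrite mem_cat; apply/orP; right.
    by apply/allpairsPdep; exists l1, l2; rewrite !mem_filter g1 g2 h1 h2.
  rewrite combE /B ler_ndivrMr ?ltrz0 // mulrAC ler_pdivrMr ?ltr0z //.
  by rewrite subr_ge0 mulrC [X in _ <= X]mulrC.
exists c => [|l lls]; first by apply: Hlo; rewrite mem_head.
rewrite dotE subr_ge0; case: (ltgtP (dot l g) 0) => lg.
- rewrite -ler_ndivrMr ?ltrz0 //; apply: Hlo; rewrite inE.
  by apply/orP; right; apply/mapP; exists l; rewrite // mem_filter lg.
- rewrite -ler_pdivlMr ?ltr0z //; apply: Hup.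
  by apply/mapP; exists l; rewrite // mem_filter lg.
- by rewrite lg mulr0; apply: Hl; rewrite mem_cat mem_filter lg lexx lls.
Qed.

(** The inequalities do not depend on the ordered field: they compare the real
    and the rational cone on the same generators. *)
Lemma cone_polyhedral n (gs : seq 'rV[int]_n) :
  exists ls : seq 'rV[int]_n, forall (F : realFieldType) (p : 'rV[F]_n),
    cone [seq int_mx F g | g <- gs] p <->
    (forall l, l \in ls -> 0 <= dot (int_mx F l) p).
Proof.
elim: gs => [|g gs [ls Hls]].
  exists ([seq delta_mx 0 i | i <- enum 'I_n] ++
          [seq - delta_mx 0 i | i <- enum 'I_n]) => F p /=.
  split=> [->|Hl]; first by move=> l _; rewrite dot0r.
  apply/rowP => i; rewrite mxE; apply/eqP; rewrite eq_le.
  have iE : i \in enum 'I_n by rewrite mem_enum.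
  have Hm x : x \in [:: delta_mx 0 i; - delta_mx 0 i] ->
      0 <= dot (int_mx F x) p.
    rewrite !inE => /orP[]/eqP->; apply: Hl; rewrite mem_cat.
      by rewrite map_f.
    by apply/orP; right; apply: map_f.
  have := Hm _ (mem_head _ _); have := Hm (- delta_mx 0 i).
  rewrite !inE eqxx orbT => /(_ isT).
  rewrite map_mxN map_delta_mx dotC dotNr dotC dot_delta oppr_ge0.
  by move=> -> ->.
exists (eliminate g ls) => F p; rewrite -eliminateP /=; split.
  move=> [c] [q] [c0 Hq ->]; exists c => //.
  by rewrite addrC addKr; apply/Hls.
move=> [c c0 Hc]; exists c, (p - c *: int_mx F g).
by split; [| apply/Hls | rewrite addrC subrK].
Qed.

(** * Finitely generated commutative monoids *)

Fixpoint nspan (N : nmodType) (gs : seq N) (v : N) : Prop :=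
  if gs is g :: gs' then exists n w, nspan gs' w /\ v = g *+ n + w
  else v = 0.

Section NSpan.
Context {N : nmodType}.
Implicit Types gs : seq N.

Lemma nspan0 gs : nspan gs 0.
Proof. by elim: gs => //= g gs IH; exists 0%N, 0; rewrite mulr0n addr0. Qed.

Lemma nspanD gs v w : nspan gs v -> nspan gs w -> nspan gs (v + w).
Proof.
elim: gs v w => /= [|g gs IH] v w; first by move=> -> ->; rewrite addr0.
move=> [m] [v'] [Hv ->] [n] [w'] [Hw ->]; exists (m + n)%N, (v' + w').
by split; [exact: IH | rewrite mulrnDr addrACA].
Qed.

Lemma nspan_mem gs g : g \in gs -> nspan gs g.
Proof.
elim: gs => //= h gs IH; rewrite inE => /predU1P[->|/IH Hg].
  by exists 1%N, 0; rewrite addr0; split=> //; exact: nspan0.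
by exists 0%N, g; rewrite mulr0n add0r.
Qed.

(** Dickson's lemma, by induction on the number of generators.  Remove the
    generator g: the elements y of the smaller monoid some g-translate of which
    lies in E have a finite basis by induction, lifted to E by finitely many
    multiples of g.  Let X bound these multiples; an element g n + y of E with
    n >= X is above a lifted basis element, and the finitely many slices n < X
    have finite bases by induction again. *)
Lemma nspan_finite_basis gs (E : set N) : (forall x, E x -> nspan gs x) ->
  exists es : seq N, (forall x, x \in es -> E x) /\
    (forall x, E x -> exists2 e, e \in es & exists s, x = e + s).
Proof.
elim: gs E => [|g gs IH] E EN.
  have [E0|nE0] := pselect (E 0).
    exists [:: 0]; split=> [x|x /EN/= ->]; first by rewrite inE => /eqP->.
    by exists 0; rewrite ?mem_head //; exists 0; rewrite addr0.
  by exists [::]; split=> // x Ex; case: nE0; rewrite -(EN _ Ex).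
have slice n : exists es : seq N, (forall x, x \in es -> E x) /\
    (forall y, nspan gs y -> E (g *+ n + y) ->
       exists2 e, e \in es & exists s, g *+ n + y = e + s).
  have [y []//|ys [ysE ysP]] := IH [set y | nspan gs y /\ E (g *+ n + y)].
  exists [seq g *+ n + y | y <- ys]; split=> [x /mapP[y /ysE[_ ?] ->]//|y Hy Ey].
  have [//|z zys [s ->]] := ysP y; exists (g *+ n + z); first exact: map_f.
  by exists s; rewrite addrA.
have [y []//|ys [ysE ysP]] :=
  IH [set y | nspan gs y /\ exists n, E (g *+ n + y)].
have lift (zs : seq N) : {subset zs <= ys} -> exists (es : seq N) X,
    (forall x, x \in es -> E x) /\
    (forall y n, y \in zs -> (X <= n)%N ->
       exists2 e, e \in es & exists s, g *+ n + y = e + s).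
  elim: zs => [|z zs IHz] zsub; first by exists [::], 0%N.
  have [|es [X [esE esP]]] := IHz.
    by move=> y yzs; rewrite zsub ?inE ?yzs ?orbT.
  have [_ [n En]] := ysE z (zsub z (mem_head _ _)).
  exists ((g *+ n + z) :: es), (maxn n X); split=> [x|y m].
    by rewrite inE => /predU1P[->//|/esE].
  rewrite inE geq_max => /predU1P[->|yzs] /andP[nm Xm].
    exists (g *+ n + z); first exact: mem_head.
    by exists (g *+ (m - n)); rewrite addrAC -mulrnDr subnKC.
  have [e ees es'] := esP y m yzs Xm; exists e => //.
  by rewrite inE ees orbT.
have [es1 [X [es1E es1P]]] := lift ys (fun _ h => h).
have [es2 [es2E es2P]] : exists es : seq N, (forall x, x \in es -> E x) /\
    (forall n y, (n < X)%N -> nspan gs y -> E (g *+ n + y) ->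
       exists2 e, e \in es & exists s, g *+ n + y = e + s).
  elim: X {es1P} => [|X [es [esE esP]]]; first by exists [::].
  have [fs [fsE fsP]] := slice X; exists (fs ++ es); split=> [x|n y].
    by rewrite mem_cat => /orP[/fsE|/esE].
  rewrite ltnS leq_eqVlt => /predU1P[->|nX] Hy Ey.
    by have [e efs es'] := fsP y Hy Ey; exists e; rewrite // mem_cat efs.
  by have [e ees es'] := esP n y nX Hy Ey; exists e; rewrite // mem_cat ees orbT.
exists (es1 ++ es2); split=> [x|x Ex].
  by rewrite mem_cat => /orP[/es1E|/es2E].
have [n [y [Hy xE]]] := EN x Ex; rewrite xE in Ex *.
have [Xn|nX] := leqP X n.
  have [|z zys [s ys']] := ysP y; first by split=> //; exists n.
  have [e ees [s' es']] := es1P z n zys Xn.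
  exists e; first by rewrite mem_cat ees.
  by exists (s' + s); rewrite ys' [LHS]addrA es' -[LHS]addrA.
have [e ees es'] := es2P n y nX Hy Ex.
exists e; first by rewrite mem_cat ees orbT.
exact: es'.
Qed.

End NSpan.

Lemma nspan_cone (F : numDomainType) (V : lmodType F) (N : nmodType)
    (h : {additive N -> V}) (gs : seq N) s :
  nspan gs s -> cone [seq h g | g <- gs] (h s).
Proof.
elim: gs s => [|g gs IH] s /=; first by move=> ->; rewrite raddf0.
move=> [n [w [Hw ->]]]; exists n%:R, (h w).
by split; [rewrite ler0n | exact: IH | rewrite raddfD raddfMn scaler_nat].
Qed.

Lemma rat_cone_nspan (N : nmodType) (V : lmodType rat) (h : {additive N -> V})
    (gs : seq N) p : cone [seq h g | g <- gs] p ->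
  exists K s, [/\ (0 < K)%N, nspan gs s & p *+ K = h s].
Proof.
elim: gs p => [|g gs IH] p /=.
  by move=> ->; exists 1%N, 0; rewrite raddf0.
move=> [c] [q] [c0 /IH[K [s [K0 Hs qs]]] ->].
exists (absz (denq c) * K)%N, (g *+ (absz (numq c) * K) + s *+ absz (denq c)).
split; first by rewrite muln_gt0 K0 absz_gt0 denq_eq0.
  exists (absz (numq c) * K)%N, (s *+ absz (denq c)); split=> //.
  by elim: (absz _) => [|n IHn]; [exact: nspan0 | rewrite mulrS; exact: nspanD].
rewrite mulrnDl raddfD !raddfMn mulnC [in q *+ _]mulrnA qs; congr (_ + _).
rewrite mulnC !mulrnA; congr (_ *+ K).
rewrite -2!scaler_nat scalerA; congr (_ *: _).
have numE : (absz (numq c))%:R = (numq c)%:~R :> rat.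
  by rewrite pmulrn gez0_abs // numq_ge0.
have denE : (absz (denq c))%:R = (denq c)%:~R :> rat by rewrite pmulrn absz_denq.
rewrite numE denE -[X in _ * X = _]divq_num_den mulrC divfK //.
by rewrite intr_eq0 denq_eq0.
Qed.

(** The integer inequalities that hold for m over F also hold over rat, so m is
    a nonnegative rational combination of the generators; clear denominators. *)
Lemma lattice_cone_nspan (F : realFieldType) n (N : nmodType)
    (f : {additive N -> 'rV[int]_n}) (gs : seq N) (m : 'rV[int]_n) :
  cone [seq int_mx F (f g) | g <- gs] (int_mx F m) ->
  exists K s, [/\ (0 < K)%N, nspan gs s & m *+ K = f s].
Proof.
have [ls Hls] := cone_polyhedral [seq f g | g <- gs].
rewrite (map_comp (fun g => int_mx F g)) => /Hls Hm.
have /(rat_cone_nspan (h := int_mx rat \o f)) [K [s [K0 Hs]]] :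
    cone [seq int_mx rat (f g) | g <- gs] (int_mx rat m).
  rewrite (map_comp (fun g => int_mx rat g)); apply/Hls => l /Hm.
  by rewrite !dot_intr !ler0z.
move=> Km; exists K, s; split=> //.
move: Km; rewrite -raddfMn /= => /rowP Km; apply/rowP => i.
by have := Km i; rewrite !mxE => /intr_inj.
Qed.

(** * Convex hulls and homogenization *)

Section Hull.
Context {R : realType}.
Implicit Types V : lmodType R.

Lemma convex_setP V (X : set V) : @convex_set R V X <->
  forall x y c, 0 <= c -> c <= 1 -> X x -> X y -> X (c *: x + (1 - c) *: y).
Proof.
split=> [cX x y c c0 c1 Xx Xy|cX x y c /set_mem Xx /set_mem Xy].
  by have := cX x y (Itv01 c0 c1) (mem_set Xx) (mem_set Xy) => /set_mem.
by apply: mem_set; apply: cX.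
Qed.

Lemma Hull_sub V (X : set V) : X `<=` Hull X.
Proof. exact: sub_gen_smallest. Qed.

Lemma Hull_min V (X Y : set V) :
  (forall x y c, 0 <= c -> c <= 1 -> Y x -> Y y -> Y (c *: x + (1 - c) *: y)) ->
  X `<=` Y -> Hull X `<=` Y.
Proof. by move=> /convex_setP cY; exact: smallest_sub. Qed.

Lemma Hull_convex V (X : set V) x y c : 0 <= c -> c <= 1 ->
  Hull X x -> Hull X y -> Hull X (c *: x + (1 - c) *: y).
Proof.
move=> c0 c1 Hx Hy Z ZP; have [/convex_setP cZ _] := ZP.
by apply: cZ; [| | exact: Hx | exact: Hy].
Qed.

(** By convexity only x + c g with x in X and g a generator matters, and this
    point lies on the segment from x to x + g n, for any integer n > c. *)
Lemma Hull_addcone V (gs : seq V) (X : set V) p q :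
  (forall x g n, X x -> g \in gs -> X (x + g *+ n)) ->
  cone gs q -> Hull X p -> Hull X (p + q).
Proof.
move=> XD Hq; move: q Hq p.
apply: (@cone_min _ _ _ (fun q => forall p, Hull X p -> Hull X (p + q))).
  by move=> p; rewrite addr0.
move=> c g q c0 ggs Hq p Hp; rewrite addrA; apply: Hq.
move: p Hp; apply: Hull_min => [x y b b0 b1 Hx Hy|x Xx /=].
  have -> : b *: x + (1 - b) *: y + c *: g
      = b *: (x + c *: g) + (1 - b) *: (y + c *: g).
    by rewrite !scalerDr addrACA -scalerDl addrC subrKC scale1r addrC.
  exact: Hull_convex.
pose n := Num.bound c.
have nc : c < n%:R by exact: archi_boundP.
have n0 : 0 < n%:R :> R by apply: le_lt_trans nc.
have -> : x + c *: g = (c / n%:R) *: (x + g *+ n) + (1 - c / n%:R) *: x.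
  rewrite scalerDr addrAC -scalerDl subrKC scale1r; congr (_ + _).
  by rewrite -scaler_nat scalerA divfK // gt_eqF.
apply: Hull_convex; rewrite ?divr_ge0 ?ler_pdivrMr ?mul1r ?(ltW nc) ?(ltW n0) //.
  by apply: Hull_sub; apply: XD.
exact: Hull_sub.
Qed.

End Hull.

Definition homog (F : pzSemiRingType) d (x : F) (p : 'rV[F]_d) : 'rV[F]_(1 + d) :=
  row_mx x%:M p.

Section Homog.
Context {F : comPzRingType} {d : nat}.
Implicit Types p q : 'rV[F]_d.

Lemma homog0 : homog 0 0 = 0 :> 'rV[F]_(1 + d).
Proof. by rewrite /homog raddf0 row_mx0. Qed.

Lemma homogD x y p q : homog x p + homog y q = homog (x + y) (p + q).
Proof. by rewrite /homog add_row_mx raddfD. Qed.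

Lemma homogZ c x p : c *: homog x p = homog (c * x) (c *: p).
Proof. by rewrite /homog scale_row_mx -scale_scalar_mx. Qed.

Lemma homog_inj x y p q : homog x p = homog y q -> x = y /\ p = q.
Proof.
by move=> /eq_row_mx[/matrixP/(_ 0 0) xy ->]; move: xy; rewrite !mxE eqxx.
Qed.

End Homog.

Lemma homog_int_mx (F : comPzRingType) d (x : int) (p : 'rV[int]_d) :
  int_mx F (homog x p) = homog x%:~R (int_mx F p).
Proof. by rewrite /homog map_row_mx map_scalar_mx. Qed.

Lemma cone_homog0 (F : numFieldType) d (ls : seq 'rV[F]_(1 + d))
    (gs : seq 'rV[F]_d) q :
  cone gs q -> cone (ls ++ [seq homog 0 g | g <- gs]) (homog 0 q).
Proof.
move: q; apply: cone_min.
  by rewrite homog0; exact: cone0.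
move=> c g q c0 ggs Hq.
have -> : homog 0 (c *: g + q) = c *: homog 0 g + homog 0 q.
  by rewrite homogZ homogD mulr0 addr0.
apply: coneD => //; apply: coneZ => //; apply: cone_mem.
by rewrite mem_cat orbC map_f.
Qed.

Lemma cone_homog0_inv (F : numFieldType) d (gs : seq 'rV[F]_d) x q :
  cone [seq homog 0 g | g <- gs] (homog x q) -> x = 0 /\ cone gs q.
Proof.
pose K z := exists2 p : 'rV[F]_d, z = homog 0 p & cone gs p.
suff KL z : cone [seq homog 0 g | g <- gs] z -> K z.
  by move=> /KL[p /homog_inj[-> ->]].
move: z; apply: cone_min; first by exists 0; [rewrite homog0 | exact: cone0].
move=> c _ _ c0 /mapP[g ggs ->] [p -> Hp]; exists (c *: g + p).
  by rewrite homogZ homogD mulr0 addr0.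
by apply: coneD => //; apply: coneZ => //; exact: cone_mem.
Qed.

(** A hull stable under translation by the generators of a cone becomes a
    finitely generated cone one dimension higher.  To read a cone element
    (x, q) back, divide by x: for x > 0 the point q / x is in the hull, and for
    x = 0 the vector q is one of the directions of the hull.  This invariant is
    K below. *)
Lemma Hull_coneP (R : realType) d (es gs : seq 'rV[R]_d) (X : set 'rV[R]_d) p :
  (forall x g n, X x -> g \in gs -> X (x + g *+ n)) ->
  (forall x, x \in es -> X x) ->
  (forall x, X x -> exists2 e, e \in es & cone gs (x - e)) ->
  Hull X p <->
  cone ([seq homog 1 e | e <- es] ++ [seq homog 0 g | g <- gs]) (homog 1 p).
Proof.
move=> XD esX Xes; set L := _ ++ _; split.
  move: p; apply: Hull_min => [x y c c0 c1 Hx Hy|x /Xes[e ees]].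
    have -> : homog 1 (c *: x + (1 - c) *: y)
        = c *: homog 1 x + (1 - c) *: homog 1 y.
      by rewrite !homogZ homogD !mulr1 subrKC.
    by apply: coneD; apply: coneZ; rewrite // subr_ge0.
  set q := x - e => Hq.
  have -> : homog 1 x = homog 1 e + homog 0 q by rewrite homogD addr0 subrKC.
  apply: coneD; first by apply: cone_mem; rewrite mem_cat map_f.
  exact: cone_homog0.
pose K z := exists x q, z = homog x q /\
  (x = 0 /\ cone gs q \/ 0 < x /\ Hull X (x^-1 *: q)).
suff KL z : cone L z -> K z.
  move=> /KL[x [q [/homog_inj[<- <-]]]].
  by rewrite invr1 scale1r => -[[/eqP]|[]//]; rewrite oner_eq0.
move: z; apply: cone_min.
  exists 0, 0; split; last by left; split=> //; exact: cone0.
  by rewrite homog0.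
move=> c g z c0 gL [x [q [-> Hx]]].
have [cE|cN0] := eqVneq c 0.
  by rewrite cE scale0r add0r; exists x, q.
have c_gt0 : 0 < c by rewrite lt0r cN0.
move: gL; rewrite mem_cat => /orP[]/mapP[] => [e ees|u ugs] ->.
  exists (c + x), (c *: e + q); split; first by rewrite homogZ homogD mulr1.
  right; case: Hx => [[-> Hq]|[x0 Hq]].
    rewrite addr0 scalerDr scalerA mulVf // scale1r; split=> //.
    apply: (Hull_addcone (gs := gs)) => //; last by apply: Hull_sub; exact: esX.
    by apply: coneZ; rewrite // invr_ge0.
  have cx0 : 0 < c + x by exact: addr_gt0.
  split=> //.
  have -> : (c + x)^-1 *: (c *: e + q)
      = (c / (c + x)) *: e + (1 - c / (c + x)) *: (x^-1 *: q).
    rewrite scalerDr !scalerA mulrC; congr (_ + _ *: _).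
    by field; rewrite !gt_eqF.
  apply: Hull_convex Hq; last by apply: Hull_sub; exact: esX.
    by rewrite divr_ge0 // ltW.
  by rewrite ler_pdivrMr // mul1r lerDl ltW.
exists x, (c *: u + q); split; first by rewrite homogZ homogD mulr0 add0r.
case: Hx => [[-> Hq]|[x0 Hq]]; [left|right]; split=> //.
  by apply: coneD => //; apply: coneZ => //; exact: cone_mem.
rewrite scalerDr addrC; apply: (Hull_addcone (gs := gs)) Hq => //.
by apply: coneZ; [rewrite invr_ge0 ltW | apply: coneZ => //; exact: cone_mem].
Qed.

(** * Monomial ideals *)

Section Ideals.
Context {A : comNzRingType}.
Implicit Types I J X : set A.

Lemma ideal_gen_ideal X : is_ideal (ideal_gen X).
Proof.
split=> [Y [[Y0 _ _] _] //|x y Hx Hy Y YP|x y Hy Y YP].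
  have [[_ YD _] _] := YP.
  by apply: YD; [exact: Hx | exact: Hy].
by have [[_ _ YM] _] := YP; apply: YM; exact: Hy.
Qed.

Lemma sub_ideal_gen X : X `<=` ideal_gen X.
Proof. exact: sub_gen_smallest. Qed.

Lemma ideal_gen_min X J : is_ideal J -> X `<=` J -> ideal_gen X `<=` J.
Proof. exact: smallest_sub. Qed.

(** Lets an inclusion of products of ideals be tested on generators. *)
Lemma ideal_colon J y : is_ideal J -> is_ideal [set x | J (y * x)].
Proof.
move=> [J0 JD JM]; split=> /= [|u v|u v]; first by rewrite mulr0.
  by rewrite mulrDr; exact: JD.
by rewrite mulrCA; exact: JM.
Qed.

Lemma ideal_pow_ideal I n : is_ideal (ideal_pow I n).
Proof. by case: n => [|n]; [|exact: ideal_gen_ideal]. Qed.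

Definition zero_product_property := forall x y : A, x * y = 0 -> x = 0 \/ y = 0.

(** In a domain the zero ideal is the only minimal prime. *)
Lemma Rcirc_domain (c : A) : zero_product_property -> Rcirc c <-> c <> 0.
Proof.
move=> dom; have zp : prime_ideal [set 0 : A].
  split; last by move=> x y; exact: dom.
    split=> [//|x y -> ->|x y ->]; first exact: addr0.
    exact: mulr0.
  by apply/eqP; rewrite oner_neq0.
split=> [Hc c0|c0 P [[[P0 _ _] _ _] /(_ _ zp) Pmin] Pc].
  apply: (Hc [set 0]) => //; split=> // Q [[Q0 _ _] _ _] Qs.
  by apply/seteqP; split=> // x ->.
by move: Pc; rewrite -Pmin => // x ->.
Qed.

End Ideals.

Fixpoint iter_sum (N : nmodType) (E : set N) n : set N :=
  if n is n'.+1 then [set v + w | v in E & w in iter_sum E n'] else [set 0].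

Section MonoidAlgebra.
Context {k : comNzRingType} {N : nmodType}.
Local Notation A := (monoid_algebra k N).
Implicit Types (f g : A) (u v w : N) (E : set N).

Lemma monomM v w : monom k v * monom k w = monom k (v + w).
Proof. by rewrite /monom [LHS]convolUU mulr1. Qed.

Lemma monom0 : monom k (0 : N) = 1. Proof. by []. Qed.

Lemma monomX v n : monom k v ^+ n = monom k (v *+ n).
Proof.
elim: n => [|n IH]; first by rewrite expr0 mulr0n monom0.
by rewrite exprS IH monomM mulrS.
Qed.

Lemma mcoeff_monom u v : mcoeff u (monom k v) = (v == u)%:R.
Proof. exact: mcoeffU. Qed.

Lemma mcoeff_monomM u f g : mcoeff u (f * g) =
  \sum_(v <- msupp f) \sum_(w <- msupp g)
     (mcoeff v f * mcoeff w g) *+ (v + w == u).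
Proof.
rewrite [f * g]/(convol f g) /convol.
rewrite [LHS](raddf_sum (@mcoeff N k u)); apply: eq_bigr => v _.
rewrite [LHS](raddf_sum (@mcoeff N k u)); apply: eq_bigr => w _.
exact: mcoeffU.
Qed.

Lemma msuppM u f g : u \in msupp (f * g) ->
  exists v w, [/\ v \in msupp f, w \in msupp g & u = v + w].
Proof.
rewrite -mcoeff_neq0 mcoeff_monomM => fgu; apply: contrapT => nvw.
case/eqP: fgu; rewrite big_seq big1 // => v vf.
rewrite big_seq big1 // => w wg; case: eqP => // vw; case: nvw.
by exists v, w.
Qed.

Lemma msupp_monom u v : u \in msupp (monom k v) -> u = v.
Proof. by move/(fsubsetP (supp_cmonom _ _)); rewrite inE => /eqP. Qed.

(** The elements whose support lies in E + N form an ideal that contains the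
    generators. *)
Lemma ideal_gen_monomP E f : ideal_gen (monom k @` E) f ->
  forall u, u \in msupp f -> exists e s, E e /\ u = e + s.
Proof.
move: f; apply: ideal_gen_min.
  split=> /= [u|f g Hf Hg u|f g Hg u].
  - by rewrite msupp0.
  - by move/(fsubsetP (msuppD_le _ _)); rewrite inE => /orP[/Hf|/Hg].
  move=> /msuppM[v [w [_ /Hg[e [s [Ee ->]]] ->]]].
  by exists e, (v + s); rewrite addrCA.
move=> _ [e Ee <-] u /msupp_monom ->.
by exists e, 0; rewrite addr0.
Qed.

Lemma Exp_ideal_genP E u :
  Exp (ideal_gen (monom k @` E)) u <-> exists e s, E e /\ u = e + s.
Proof.
split=> [/ideal_gen_monomP|[e [s [Ee ->]]]].
  by apply; rewrite -mcoeff_neq0 mcoeff_monom eqxx oner_neq0.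
rewrite /Exp /= addrC -monomM; have [_ _] := ideal_gen_ideal (monom k @` E).
by apply; apply: sub_ideal_gen; exists e.
Qed.

Lemma ideal_pow_monom E n :
  ideal_pow (ideal_gen (monom k @` E)) n = ideal_gen (monom k @` iter_sum E n).
Proof.
elim: n => [|n IH] /=.
  apply/seteqP; split=> // x _.
  have [_ _ IM] := ideal_gen_ideal (monom k @` [set (0 : N)]).
  by rewrite -[x]mulr1; apply: IM; apply: sub_ideal_gen; exists 0.
rewrite /ideal_pow /= -/(ideal_pow _ _) IH /ideal_mul.
have JI := ideal_gen_ideal (monom k @` [set v + w | v in E & w in iter_sum E n]).
apply/seteqP; split; apply: ideal_gen_min => //; try exact: ideal_gen_ideal.
  move=> _ [x Hx [y Hy <-]]; move: y Hy.
  apply: (ideal_gen_min (ideal_colon x JI)) => _ [w Ew <-] /=.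
  rewrite mulrC; move: x Hx.
  apply: (ideal_gen_min (ideal_colon (monom k w) JI)) => _ [v Ev <-] /=.
  rewrite monomM addrC; apply: sub_ideal_gen; exists (v + w) => //.
  by exists v => //; exists w.
move=> _ [_ [v Ev [w Ew <-]] <-]; apply: sub_ideal_gen.
exists (monom k v); first by apply: sub_ideal_gen; exists v.
by exists (monom k w); [apply: sub_ideal_gen; exists w | exact: monomM].
Qed.

Lemma mcoeff_mul_monom f u w : injective (fun v => v + u) ->
  mcoeff (w + u) (f * monom k u) = mcoeff w f.
Proof.
move=> u_inj; rewrite [f]cmonom_sum mulr_suml.
rewrite [LHS](raddf_sum (@mcoeff N k _)) [RHS](raddf_sum (@mcoeff N k _)).
apply: eq_bigr => v _; rewrite [_ * _]convolUU [LHS]mcoeffU [RHS]mcoeffU mulr1.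
by rewrite (inj_eq u_inj).
Qed.

End MonoidAlgebra.

Lemma ideal_pow_le (A : comNzRingType) (I : set A) m n : (m <= n)%N ->
  ideal_pow I n `<=` ideal_pow I m.
Proof.
move=> mn; rewrite -(subnK mn); elim: (n - m)%N => // i IH.
apply: subset_trans IH; rewrite addSn.
apply: ideal_gen_min; first exact: ideal_pow_ideal.
by move=> _ [x _ [y Hy <-]]; have [_ _] := ideal_pow_ideal I (i + m); apply.
Qed.

Section IterSum.
Context {N : nmodType} (E : set N).

Lemma iter_sumD m n v w :
  iter_sum E m v -> iter_sum E n w -> iter_sum E (m + n) (v + w).
Proof.
elim: m v => [|m IH] v /=; first by move=> ->; rewrite add0r.
move=> [x Ex [y Hy <-]] Hw; exists x => //; exists (y + w); first exact: IH.
by rewrite addrA.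
Qed.

Lemma iter_sumMn e n : E e -> iter_sum E n (e *+ n).
Proof.
move=> Ee; elim: n => //= n IH.
by exists e => //; exists (e *+ n) => //; rewrite mulrS.
Qed.

End IterSum.

(** * Monoid algebras of lattice monoids are domains *)

Lemma int_nonroot (p : {poly int}) : p != 0 -> exists b, ~~ root p b.
Proof.
move=> p0; pose rs := [seq i%:Z | i <- iota 0 (size p)].
have rs_uniq : uniq rs by rewrite map_inj_uniq ?iota_uniq // => i j [].
have [all_rt|] := boolP (all (root p) rs).
  by have := max_poly_roots p0 all_rt rs_uniq; rewrite size_map size_iota ltnn.
by case/allPn => b _ ?; exists b.
Qed.

(** Kronecker substitution: read a vector as the coefficients of a polynomial
    and evaluate it at an integer b.  Two points of D collide only if b is a
    root of the polynomial of their difference, and finitely many nonzero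
    polynomials have a common integer nonroot. *)
Lemma separating_functional (N : nmodType) n (h : {additive N -> 'rV[int]_n})
    (D : seq N) : injective h ->
  exists phi : N -> int, {morph phi : v w / v + w} /\ {in D &, injective phi}.
Proof.
move=> h_inj.
pose p := \prod_(z <- [seq (v, w) | v <- D, w <- D] | z.1 != z.2)
  rVpoly (h z.1 - h z.2).
have [|b pb] := @int_nonroot p.
  rewrite prodf_seq_neq0; apply/allP => -[v w] _; apply/implyP => /= vw.
  apply: contra_neq vw => /(congr1 (@poly_rV _ n)).
  by rewrite rVpolyK raddf0 => /subr0_eq /h_inj.
exists (fun v => (rVpoly (h v)).[b]); split=> [v w|v w vD wD vw].
  by rewrite !raddfD hornerD.
apply: contraNeq pb => v_neq_w; rewrite /p (big_rem (v, w)) /=; last first.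
  by apply/allpairsP; exists (v, w).
by rewrite v_neq_w rootM /root raddfB hornerD hornerN vw subrr eqxx.
Qed.

Lemma seq_argmax (T : eqType) (phi : T -> int) (s : seq T) : s != [::] ->
  exists2 x, x \in s & forall y, y \in s -> phi y <= phi x.
Proof.
elim: s => // x [|y s] IH _.
  by exists x; rewrite ?mem_head // => z; rewrite inE => /eqP->.
have [//|z zs zmax] := IH; have [xz|zx] := leP (phi x) (phi z).
  exists z; first by rewrite inE zs orbT.
  by move=> t; rewrite inE => /predU1P[->|/zmax].
exists x; first exact: mem_head.
move=> t; rewrite inE => /predU1P[->//|/zmax tz].
exact: le_trans tz (ltW zx).
Qed.

(** A functional phi that is injective on both supports gives f and g unique
    terms of highest phi-degree; the product of these two terms cannot cancel
    in f g. *)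
Lemma monoid_algebra_domain (k : idomainType) (N : nmodType) n
    (h : {additive N -> 'rV[int]_n}) : injective h ->
  @zero_product_property (monoid_algebra k N).
Proof.
move=> h_inj f g fg0; apply: contrapT => /not_orP[/eqP f0 /eqP g0].
have [phi [phiD phi_inj]] :=
  separating_functional (enum_fset (msupp f) ++ enum_fset (msupp g)) h_inj.
have maxsupp (q : monoid_algebra k N) : q != 0 ->
    exists2 v, v \in msupp q & forall w, w \in msupp q -> phi w <= phi v.
  move=> q0; have := @seq_argmax _ phi (enum_fset (msupp q)).
  apply; apply: contra_neq q0 => q0.
  by rewrite [q]cmonom_sum q0 big_nil.
have [v vf vmax] := maxsupp f f0; have [w wg wmax] := maxsupp g g0.
have : mcoeff (v + w) (f * g) = mcoeff v f * mcoeff w g.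
  rewrite mcoeff_monomM (bigD1_seq v) ?fset_uniq //= (bigD1_seq w) ?fset_uniq //=.
  rewrite eqxx mulr1n big_seq_cond big1 => [|w' /andP[w'g w'w]]; last first.
    have [/(congr1 phi)|//] := eqVneq (v + w') (v + w).
    rewrite !phiD => /addrI /phi_inj w'E; case/eqP: w'w; apply: w'E.
    - by rewrite mem_cat w'g orbT.
    - by rewrite mem_cat wg orbT.
  rewrite addr0 big_seq_cond big1 ?addr0 // => v' /andP[v'f v'v].
  rewrite big_seq big1 // => w' w'g.
  have [/(congr1 phi)|//] := eqVneq (v' + w') (v + w).
  rewrite !phiD => E; case/eqP: v'v; apply: phi_inj.
  - by rewrite mem_cat v'f.
  - by rewrite mem_cat vf.
  apply/eqP; rewrite eq_le (vmax _ v'f) -(lerD2r (phi w)) -E lerD2l.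
  exact: wmax.
rewrite fg0 mcoeff0 => /esym/eqP; rewrite mulf_eq0 !mcoeff_eq0.
by rewrite vf wg.
Qed.

(** * Normality and finite generation of the exponent monoid *)

(** Phrased inside the monoid: if n (x - y) is in N, so is x - y. *)
Definition saturated (N : nmodType) := forall (x y s : N) (n : nat),
  (0 < n)%N -> x *+ n = y *+ n + s -> exists s', x = y + s'.

(** The quotient z of the monomials at x and y has the monomial at s as its
    n-th power, so it is integral over the algebra and lies in it.  A multiple
    of the monomial at y has its support in y + N, and x is in the support. *)
Lemma normal_saturated (k : comNzRingType) (N : nmodType) :
  (forall u : N, injective (fun v => v + u)) ->
  normal_domain (monoid_algebra k N) -> saturated N.
Proof.
move=> inj [K [f [[f_inj _] intK]]] x y s n n0 xys.
have fm0 w : f (monom k w) != 0.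
  rewrite -(rmorph0 f); apply/eqP => /f_inj/(congr1 (mcoeff w)).
  by move/eqP; rewrite mcoeff_monom eqxx mcoeff0 oner_eq0.
pose z := f (monom k x) / f (monom k y).
have [|g zg] := intK z.
  exists ('X^n - (monom k s)%:P); first exact: monicXnsubC.
  rewrite rmorphB /= map_polyXn map_polyC /= rootE !hornerE subr_eq0.
  rewrite /z expr_div_n -!rmorphXn !monomX xys -monomM rmorphM.
  by rewrite mulrAC divff ?mul1r.
have xE : monom k x = g * monom k y.
  by apply: f_inj; rewrite rmorphM -zg divfK.
have : x \in msupp (g * monom k y).
  by rewrite -xE -mcoeff_neq0 mcoeff_monom eqxx oner_neq0.
by move=> /msuppM[s' [y' [_ /msupp_monom-> ->]]]; exists s'; rewrite addrC.
Qed.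

Lemma fg_submonoid_nspan (M : zmodType) (S : addrClosed M) : fg_submonoid S ->
  exists gs : seq (submonoid S), forall s, nspan gs s.
Proof.
move=> [gs0 [gsS gsmin]]; pose gs : seq (submonoid S) := pmap insub gs0.
exists gs; pose T0 : {pred M} :=
  [pred m | `[< exists2 s, val s = m & nspan gs s >]].
have T0P m : reflect (exists2 s, val s = m & nspan gs s) (m \in T0).
  exact: asboolP.
have T0_closed : addr_closed T0.
  split=> [|_ _ /T0P[s <- Hs] /T0P[t <- Ht]]; apply/T0P.
    by exists 0; [exact: raddf0 | exact: nspan0].
  by exists (s + t); [exact: raddfD | exact: nspanD].
pose T : addrClosed M := HB.pack T0 (GRing.isAddClosed.Build M T0 T0_closed).
move=> s; have : val s \in T.
  apply: gsmin (valP s) => g ggs; apply/T0P.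
  exists (Sub g (gsS g ggs)); first exact: SubK.
  by apply: nspan_mem; rewrite mem_pmap_sub SubK.
by move=> /T0P[s' /val_inj ->].
Qed.

(** * Closure and hull for a finitely generated lattice monoid *)

Lemma ge0_affine_nat (F : archiRealFieldType) (x c : F) n0 :
  (forall n, (n0 <= n)%N -> 0 <= n%:R * x + c) -> 0 <= x.
Proof.
move=> Hn; rewrite leNgt; apply/negP => x0.
have nx0 : 0 < - x by rewrite oppr_gt0.
pose n := maxn n0 (Num.bound (`|c| / - x)).
have := Hn n (leq_maxl _ _).
have : `|c| / - x < n%:R.
  apply: lt_le_trans (archi_boundP _) _; first by rewrite divr_ge0 // ltW.
  by rewrite ler_nat leq_maxr.
rewrite ltr_pdivrMr // mulrN => cn; have := ler_norm c; lra.
Qed.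

Lemma natr_ceil (R : archiRealFieldType) (x : R) : 0 <= x ->
  x <= (absz (Num.ceil x))%:R < x + 1.
Proof.
move=> x0; have c0 : 0 <= Num.ceil x.
  by rewrite ceil_ge0 (lt_le_trans _ x0) ?ltrN10.
have -> : (absz (Num.ceil x))%:R = (Num.ceil x)%:~R :> R.
  by rewrite pmulrn gez0_abs.
by rewrite ceil_ge /= -ltrBlDr -[1]/(1%:~R) -rmorphB ceilB1_lt.
Qed.

Section AffineMonoid.
Context (R : realType) (N : nmodType) (d : nat).
Context (iota : {additive N -> 'rV[int]_d}).
Hypothesis iota_inj : injective iota.
Context (gs : seq N).
Hypothesis gs_span : forall s, nspan gs s.

Definition emb (s : N) : 'rV[R]_d := int_mx R (iota s).

HB.instance Definition _ := GRing.Additive.copy emb (int_mx R \o iota).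

(** The generators of the cone over the convex hull of the points of es plus the
    cone of the monoid, kept integral so that the field can be chosen later. *)
Definition hull_gens (es : seq N) : seq 'rV[int]_(1 + d) :=
  [seq homog 1 (iota e) | e <- es] ++ [seq homog 0 (iota g) | g <- gs].

Lemma map_hull_gens es : [seq int_mx R l | l <- hull_gens es] =
  [seq homog 1 x | x <- map emb es] ++ [seq homog 0 x | x <- map emb gs].
Proof.
rewrite /hull_gens map_cat -!map_comp.
by congr (_ ++ _); apply: eq_map => e /=; rewrite homog_int_mx.
Qed.

Lemma emb_cone s : cone (map emb gs) (emb s).
Proof. by apply: nspan_cone; exact: gs_span. Qed.

(** Dickson's lemma makes the exponents of the ideal a finite union of translates
    of the monoid, so that finitely many generators suffice. *)
Lemma Hull_Exp_cone (k : comNzRingType) (E : set N) :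
  exists es : seq N, (forall e, e \in es -> E e) /\ forall p,
    Hull (emb @` Exp (ideal_gen (monom k @` E))) p <->
    cone [seq int_mx R l | l <- hull_gens es] (homog 1 p).
Proof.
have [es [esE Ees]] := @nspan_finite_basis _ gs E (fun x _ => gs_span x).
exists es; split=> // p; rewrite map_hull_gens; apply: Hull_coneP.
- move=> _ _ n [x /Exp_ideal_genP[e [s [Ee ->]]] <-] /mapP[g _ ->].
  exists (e + s + g *+ n); last by rewrite !raddfD raddfMn.
  by apply/Exp_ideal_genP; exists e, (s + g *+ n); rewrite addrA.
- move=> _ /mapP[e /esE Ee ->]; exists e => //.
  by apply/Exp_ideal_genP; exists e, 0; rewrite addr0.
- move=> _ [x /Exp_ideal_genP[e [s [/Ees[e' e'es [s' ->]] ->]]] <-].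
  exists (emb e'); first exact: map_f.
  by rewrite -addrA raddfD addrAC subrr add0r; exact: emb_cone.
Qed.

(** Each inequality l >= 0 of the cone over the hull takes at
    (n, w + n v + m a) the value n X + Y w + (m - t n) Y a, where X is its value
    at (1, v + t a); the last two terms are bounded because
    0 <= m - t n < 1. *)
Lemma closure_sub_Hull (k : idomainType) (E A : set N) (t : R) v a :
  0 <= t -> A a ->
  a_t_closure (ideal_gen (monom k @` E)) (ideal_gen (monom k @` A)) t
    (monom k v) ->
  Hull (emb @` Exp (ideal_gen (monom k @` E))) (emb v + t *: emb a).
Proof.
move=> t0 Aa [c Rc [n0 _ Hn]].
have /eqP c0 := (Rcirc_domain c (monoid_algebra_domain (k := k) iota_inj)).1 Rc.
have [w wc] : exists w, w \in msupp c.
  apply: contrapT => nw; case/eqP: c0.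
  rewrite [c]cmonom_sum big_seq big1 // => w wc.
  by case: nw; exists w.
have [es [_ HullE]] := Hull_Exp_cone k E.
have [ls Hls] := cone_polyhedral (hull_gens es).
have cone_sum n e : iter_sum E n e ->
    cone [seq int_mx R l | l <- hull_gens es] (homog n%:R (emb e)).
  elim: n e => [|n IH] e /=.
    by move=> ->; rewrite mulr0n raddf0 homog0; exact: cone0.
  move=> [x Ex [y Hy <-]]; rewrite raddfD -nat1r -homogD.
  apply: coneD; last exact: IH.
  apply/HullE; apply: Hull_sub; exists x => //.
  by apply/Exp_ideal_genP; exists x, 0; rewrite addr0.
have cone_emb s : cone [seq int_mx R l | l <- hull_gens es] (homog 0 (emb s)).
  by rewrite map_hull_gens; apply: cone_homog0; exact: emb_cone.
apply/HullE/Hls => l lls.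
set X := dot _ _; pose Y x := dot (int_mx R l) (homog 0 (emb x)).
apply: (@ge0_affine_nat _ X (`|Y w| + `|Y a|) n0) => n n0n.
pose m := absz (Num.ceil (t * n%:R)).
have tn0 : 0 <= t * n%:R by rewrite mulr_ge0.
have /andP[tm mt] := natr_ceil tn0; rewrite -/m in tm mt.
have /(Hn n n0n) : ideal_pow (ideal_gen (monom k @` A)) m (monom k (a *+ m)).
  rewrite ideal_pow_monom; apply: sub_ideal_gen.
  by exists (a *+ m) => //; exact: iter_sumMn.
rewrite ideal_pow_monom monomX -mulrA monomM => /ideal_gen_monomP.
set u := _ + _ => /(_ (w + u)) [].
  rewrite -mcoeff_neq0 mcoeff_mul_monom ?mcoeff_neq0 // => x y /(congr1 iota).
  by rewrite !raddfD => /addIr/iota_inj.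
move=> e [s [He wue]].
have /Hls/(_ _ lls) : cone [seq int_mx R l | l <- hull_gens es]
    (homog n%:R (emb (w + u))).
  by rewrite wue raddfD -[n%:R]addr0 -homogD; apply: coneD; [exact: cone_sum|].
have -> : homog n%:R (emb (w + u)) = n%:R *: homog 1 (emb v + t *: emb a) +
    (homog 0 (emb w) + (m%:R - t * n%:R) *: homog 0 (emb a)).
  rewrite /u !raddfD !raddfMn -!scaler_nat !homogZ !homogD mulr0 mulr1 !addr0.
  congr homog; rewrite scalerDr scalerA scalerBl [n%:R * t]mulrC [RHS]addrCA.
  by congr (_ + _); rewrite -addrA subrKC.
rewrite !dotDr !dotZr -/X -!/(Y _) => H; apply: le_trans H _.
rewrite lerD2l lerD ?ler_norm //; apply: le_trans (ler_norm _) _.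
rewrite normrM ler_piMl // ger0_norm ?subr_ge0 //.
by rewrite lerBlDl ltW.
Qed.

(** Each coefficient c at a generator (1, e) is replaced by floor c + 1.  This
    asks for one extra copy of e, and leaves the multiple c - floor c of e,
    which is in the cone of the monoid. *)
Lemma cone_round_up (E : set N) (es : seq N) (x : R) p :
  (forall e, e \in es -> E e) ->
  cone [seq int_mx R l | l <- hull_gens es] (homog x p) ->
  exists n z, [/\ iter_sum E n z, x <= n%:R &
    cone (map emb gs) (p + emb (\sum_(e <- es) e) - emb z)].
Proof.
move=> esE; rewrite map_hull_gens; elim: es esE x p => [|e es IH] esE x p.
  move=> /cone_homog0_inv[-> Hp]; exists 0%N, 0.
  by rewrite big_nil (raddf0 emb) addr0 subr0.
rewrite big_cons => -[c [z [c0 Hz zE]]].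
have /andP[fc cf] := truncn_itv c0; set f := Num.truncn c in fc cf.
have {zE}zE : z = homog (x - c) (p - c *: emb e).
  by rewrite -[z](addKr (c *: homog 1 (emb e))) -zE -scaleN1r !homogZ homogD
    !mulN1r mulr1 scaleN1r addrC [- _ + p]addrC.
have esE' e' : e' \in es -> E e'.
  by move=> e'es; apply: esE; rewrite inE e'es orbT.
have := IH esE' (x - c) (p - c *: emb e).
rewrite -zE => /(_ Hz)[n [z' [Hz' xn Hcone]]].
exists (f.+1 + n)%N, (e *+ f.+1 + z'); split.
- by apply: iter_sumD => //; apply: iter_sumMn; apply: esE; rewrite mem_head.
- by rewrite natrD -lerBlDl; apply: le_trans xn; rewrite lerD2l lerN2 ltW.
set w := \sum_(j <- es) j in Hcone *.
have -> : p + emb (e + w) - emb (e *+ f.+1 + z') =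
    (c - f%:R) *: emb e + (p - c *: emb e + emb w - emb z').
  rewrite !raddfD raddfMn /= mulrSr -scaler_nat scalerBl.
  move: (c *: emb e) (f%:R *: emb e) => y y'.
  apply/rowP => i; rewrite !mxE; ring.
apply: coneD => //; apply: coneZ; last exact: emb_cone.
by rewrite subr_ge0.
Qed.

(** The witness is x^c with c the sum of the finite basis es of E, which pays
    for the rounding whatever n and u are. *)
Lemma Hull_sub_closure (k : idomainType) (E A : set N) (t : R) v :
  saturated N -> 0 < t ->
  (forall a, A a ->
     Hull (emb @` Exp (ideal_gen (monom k @` E))) (emb v + t *: emb a)) ->
  a_t_closure (ideal_gen (monom k @` E)) (ideal_gen (monom k @` A)) t
    (monom k v).
Proof.
move=> satN t0 HA; have [es [esE HullE]] := Hull_Exp_cone k E.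
pose c : N := \sum_(e <- es) e.
exists (monom k c).
  apply/(Rcirc_domain _ (monoid_algebra_domain (k := k) iota_inj)).
  by move/(congr1 (mcoeff c))/eqP; rewrite mcoeff_monom eqxx mcoeff0 oner_eq0.
(* From n = 1 on, m = ceil (t n) is positive and can be divided by. *)
exists 1%N => // n /= n0; set m := absz _.
have tn0 : 0 < t * n%:R by rewrite mulr_gt0 ?ltr0n.
have /andP[tm _] := natr_ceil (ltW tn0); rewrite -/m in tm.
have m0 : 0 < m%:R :> R by exact: lt_le_trans tm.
rewrite ideal_pow_monom monomX monomM.
apply: ideal_gen_min; first exact: ideal_colon (ideal_pow_ideal _ _).
move=> _ [u Hu <-] /=; rewrite monomM.
(* The j points (1, v + t a) for the summands a of w add up to
   (j, j v + t w). *)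
have cone_sum j w : iter_sum A j w ->
    cone [seq int_mx R l | l <- hull_gens es]
      (homog j%:R (j%:R *: emb v + t *: emb w)).
  elim: j w => [|j IH] w /=.
    by move=> ->; rewrite mulr0n raddf0 scale0r scaler0 addr0 homog0; exact: cone0.
  move=> [x Ax [y Hy <-]]; rewrite raddfD -nat1r scalerDl scale1r scalerDr.
  by rewrite addrACA -homogD; apply: coneD; [apply/HullE; exact: HA | exact: IH].
have : cone [seq int_mx R l | l <- hull_gens es]
    (homog n%:R (emb (v *+ n + u))).
  (* Rescaling by n / m <= 1 / t turns m v + t u into n v + (t n / m) u, and
     the missing multiple of u is nonnegative because m >= t n. *)
  have -> : homog n%:R (emb (v *+ n + u)) =
      (n%:R / m%:R) *: homog m%:R (m%:R *: emb v + t *: emb u) +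
      homog 0 ((1 - t * n%:R / m%:R) *: emb u).
    rewrite homogZ homogD addr0 raddfD raddfMn -scaler_nat.
    rewrite divfK ?gt_eqF // scalerDr !scalerA divfK ?gt_eqF // -addrA -scalerDl.
    rewrite [n%:R / m%:R * t]mulrC mulrA [t * n%:R / m%:R + _]addrC subrK.
    by rewrite scale1r.
  apply: coneD; first by apply: coneZ (cone_sum _ _ Hu); rewrite divr_ge0.
  rewrite map_hull_gens; apply: cone_homog0; apply: coneZ (emb_cone u).
  by rewrite subr_ge0 ler_pdivrMr // mul1r.
move=> /(cone_round_up esE)[j [z [Hz nj]]]; rewrite ler_nat in nj.
rewrite -raddfD -/c => Hcone.
have [K [s [K0 _]]] : exists K s, [/\ (0 < K)%N, nspan gs s &
    (iota (v *+ n + u + c) - iota z) *+ K = iota s].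
  by apply: (@lattice_cone_nspan R); rewrite map_mxB.
rewrite mulrnBl -!raddfMn => /eqP.
rewrite subr_eq -raddfD [s + _]addrC => /eqP/iota_inj xE.
have [s' uE] := satN _ _ _ _ K0 xE.
apply: (ideal_pow_le nj); rewrite ideal_pow_monom.
have -> : c + v *+ n + u = v *+ n + u + c by rewrite -addrA addrC.
by rewrite uE; apply/Exp_ideal_genP; exists z, s'.
Qed.

End AffineMonoid.

Theorem theorem6p8 (R : realType) (k : fieldType) (d : nat)
    (M : zmodType) (e : {additive M -> 'rV[int]_d}) (e_bij : bijective e)
    (S : addrClosed M) (S_fg : fg_submonoid S) (S_gen : generates_group S)
    (I : set (monoid_algebra k (submonoid S))) (I_monomial : is_monomial_ideal I)
    (A : seq (submonoid S)) (t : R) (t_gt0 : 0 < t) (v : submonoid S) :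
  let emb (w : submonoid S) : 'rV[R]_d := real_coords R e (val w) in
  let a := ideal_gen [set monom k w | w in [set` A]] in
  let H := Hull [set emb w | w in [set` A]] in
  let inclusion :=
    [set emb v + t *: h | h in H] `<=` Hull [set emb w | w in Exp I] in
  (a_t_closure I a t (monom k v) -> inclusion) /\
  (normal_domain (monoid_algebra k (submonoid S)) ->
   inclusion -> a_t_closure I a t (monom k v)).
Proof.
case: I_monomial => E ->; have [gs gs_span] := fg_submonoid_nspan S_fg.
pose iota : {additive submonoid S -> 'rV[int]_d} := e \o val.
have iota_inj : injective iota.
  by apply: inj_comp; [exact: bij_inj | exact: val_inj].
move=> /=; split=> [Hcl _ [q Hq <-]|nrm incl].
  move: q Hq; apply: Hull_min => [x y c c0 c1 Hx Hy|_ [a Aa <-] /=].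
    have -> : real_coords R e (val v) + t *: (c *: x + (1 - c) *: y) =
        c *: (real_coords R e (val v) + t *: x) +
        (1 - c) *: (real_coords R e (val v) + t *: y).
      rewrite 2!(scalerDr _ (real_coords _ _ _)) addrACA -scalerDl subrKC scale1r.
      by rewrite scalerDr !scalerA ![_ * t]mulrC.
    exact: Hull_convex.
  exact: (closure_sub_Hull iota_inj gs_span (ltW t_gt0) Aa Hcl).
apply: (Hull_sub_closure iota_inj gs_span _ t_gt0) => [|a Aa].
  apply: normal_saturated nrm => u x y /(congr1 iota).
  by rewrite !raddfD => /addIr/iota_inj.
by apply: incl; exists (real_coords R e (val a)) => //; apply: Hull_sub; exists a.
Qed.
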